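(* Let $\mathcal G_0$ be the initial mesh and let $\mathcal G_0,\mathcal G_1,\dots,\mathcal G_J$ be any sequence of admissible meshes with \[\mathcal G_j=\operatorname{ref}^{p,q}(\mathcal G_{j-1},\mathcal M_{j-1}),\quad \mathcal M_{j-1}\subseteq\mathcal G_{j-1}\quad\text{for } j\in\{1,\dots,J\}.\] Then \[|\mathcal G_J\setminus\mathcal G_0|\ \le\ C_{p,q}\sum_{j=0}^{J-1}|\mathcal M_j|,\] where $|\cdot|$ denotes cardinality, $C_{p,q}=(3+\sqrt2)(4d_p+1)(4d_q+\sqrt2)$, $d_p=\tfrac12+(1+\sqrt2)(p+\sqrt2)$ and $d_q=\tfrac1{\sqrt2}+(2+\sqrt2)(q+\sqrt2)$.
   Context: Fix integers $p,q\ge 2$ (polynomial degrees) and positive integers $M,N$. Initial mesh: $\mathcal G_0=\{[m-1,m]\times[n-1,n]\mid 1\le m\le M,\ 1\le n\le N\}$, and $\overline\Omega=\bigcup\mathcal G_0=[0,M]\times[0,N]$. Elements are closed axis-parallel rectangles; a mesh is a set of elements obtained from $\mathcal G_0$ by bisections as defined below. Level: $\ell(K)=-\log_2|K|$, where $|K|$ is the area of the element $K$. Distance: for elements $K_1,K_2$, $\operatorname{Dist}(K_1,K_2)\in\mathbb R^2$ is the componentwise absolute value of $\operatorname{mid}(K_1)-\operatorname{mid}(K_2)$, where $\operatorname{mid}$ denotes the midpoint. Inequalities between vectors are componentwise. Patch: $\mathcal G^{p,q}(K)=\{K'\in\mathcal G\mid \operatorname{Dist}(K',K)\le \mathbf D^{p,q}(\ell(K))\}$,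 where $\mathbf D^{p,q}(k)=2^{-k/2}\bigl(\lfloor p/2\rfloor+\tfrac12,\ \lceil q/2\rceil+\tfrac12\bigr)$ if $k$ is even and $\mathbf D^{p,q}(k)=2^{-(k+1)/2}\bigl(\lceil p/2\rceil+\tfrac12,\ 2\lfloor q/2\rfloor+1\bigr)$ if $k$ is odd. Bisection: for $K=[\mu,\mu+\tilde\mu]\times[\nu,\nu+\tilde\nu]$, $\operatorname{child}(K)$ is the pair of rectangles obtained by halving $K$ in the $x$-direction (i.e. cutting along $x=\mu+\tilde\mu/2$) if $\ell(K)$ is even, and by halving $K$ in the $y$-direction (cutting along $y=\nu+\tilde\nu/2$) if $\ell(K)$ is odd. For $K\in\mathcal G$, $\operatorname{bisect}(\mathcal G,K)=(\mathcal G\setminus\{K\})\cup\operatorname{child}(K)$; for $\mathcal M=\{K_1,\dots,K_J\}\subseteq\mathcal G$, $\operatorname{bisect}(\mathcal G,\mathcal M)$ is the result of successively bisecting $K_1,\dots,K_J$ (in arbitrary order). Admissibility: the bisection of $K\in\mathcal G$ is admissible if all $K'\in\mathcal G^{p,q}(K)$ satisfy $\ell(K')\ge\ell(K)$. The bisection $\operatorname{bisect}(\mathcal G,\mathcal M)$ of several elements is admissible if the elements of $\mathcal M$ can be ordered such that it is a concatenation of admissible bisections of single elements (each with respect to the current mesh). A mesh $\mathcal G$ is admissible if it is $\mathcal G_0$ or there are meshes $\mathcal G_1,\dots,\mathcal G_J=\mathcal G$ and sets $\mathcal M_j\subseteq\mathcal G_j$ such that $\mathcal G_{j+1}=\operatorname{bisect}(\mathcal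 G_j,\mathcal M_j)$ is an admissible bisection for $j=0,\dots,J-1$. $\mathbb A^{p,q}$ is the set of all admissible meshes. Closure and refinement: for $\mathcal M\subseteq\mathcal G$, $\operatorname{clos}^{p,q}_{\mathcal G}(\mathcal M)$ is the smallest set $\tilde{\mathcal M}$ with $\mathcal M\subseteq\tilde{\mathcal M}\subseteq\mathcal G$ such that for every $K\in\tilde{\mathcal M}$, all $K'\in\mathcal G^{p,q}(K)$ with $\ell(K')<\ell(K)$ belong to $\tilde{\mathcal M}$ (computed by starting with $\mathcal M$ and repeatedly adding such $K'$ until the set stops growing). Then $\operatorname{ref}^{p,q}(\mathcal G,\mathcal M)=\operatorname{bisect}(\mathcal G,\operatorname{clos}^{p,q}_{\mathcal G}(\mathcal M))$. *)

(* Defs.v *)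
From HB Require Import structures.
From mathcomp Require Import all_boot all_order all_algebra finmap.
From mathcomp Require Import all_classical all_reals all_analysis.
Set Implicit Arguments.
Unset Strict Implicit.
Unset Printing Implicit Defensive.
Import Order.TTheory GRing.Theory Num.Theory.
Local Open Scope fset_scope.
Local Open Scope ring_scope.

(* [Rect a b c d] stands for the closed rectangle [a, b] x [c, d].  Only
   rectangles with a < b and c < d occur in meshes, so that equality of the
   records is equality of the rectangles as sets. *)
Record rect (R : realType) := Rect { xl : R; xr : R; yl : R; yr : R }.

Definition rect_code (R : realType) (K : rect R) := (xl K, xr K, yl K, yr K).
Definition rect_decode (R : realType) (t : R * R * R * R) :=
  Rect t.1.1.1 t.1.1.2 t.1.2 t.2.

Lemma rect_codeK (R : realType) : cancel (@rect_code R) (@rect_decode R).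
Proof. by case. Qed.

HB.instance Definition _ (R : realType) :=
  Choice.copy (rect R) (can_type (@rect_codeK R)).

Section Elements.
Context {R : realType}.
Implicit Types K : rect R.

Definition area K : R := (xr K - xl K) * (yr K - yl K).

Definition mid K : R * R := ((xl K + xr K) / 2, (yl K + yr K) / 2).

Definition level K : R := - (ln (area K) / ln 2).

(* Levels are kept real-valued, hence parity is a predicate on R.  The elements
   of a mesh have natural levels, for which "not even" means "odd". *)
Definition even_level (k : R) : bool := k / 2 \is a Num.int.

Definition Dist K1 K2 : R * R :=
  (`|(mid K1).1 - (mid K2).1|, `|(mid K1).2 - (mid K2).2|).

(* [p./2] is the floor and [uphalf p] the ceiling of p/2. *)
Definition Dpq (p q : nat) (k : R) : R * R :=
  if even_level k
  then (2 `^ (- (k / 2)) * ((p./2)%:R + 1 / 2),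
        2 `^ (- (k / 2)) * ((uphalf q)%:R + 1 / 2))
  else (2 `^ (- ((k + 1) / 2)) * ((uphalf p)%:R + 1 / 2),
        2 `^ (- ((k + 1) / 2)) * (2 * (q./2)%:R + 1)).

Definition child K : {fset rect R} :=
  if even_level (level K)
  then let c := (xl K + xr K) / 2 in
       [fset Rect (xl K) c (yl K) (yr K); Rect c (xr K) (yl K) (yr K)]
  else let c := (yl K + yr K) / 2 in
       [fset Rect (xl K) (xr K) (yl K) c; Rect (xl K) (xr K) c (yr K)].

End Elements.

Section Meshes.
Context {R : realType}.
Implicit Types (G S T : {fset rect R}) (K : rect R).

Definition mesh0 (M N : nat) : {fset rect R} :=
  [fset Rect (m%:R - 1) m%:R (n%:R - 1) n%:R | m in iota 1 M, n in iota 1 N].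

Definition patch (p q : nat) G K : {fset rect R} :=
  [fset K' in G | ((Dist K' K).1 <= (Dpq p q (level K)).1) &&
                  ((Dist K' K).2 <= (Dpq p q (level K)).2)].

Definition bisect1 G K : {fset rect R} := (G `\ K) `|` child K.

(* The successive bisections follow the enumeration of S.  For a mesh G and
   S `<=` G the order is irrelevant: the children of an element of G are not
   elements of G. *)
Definition bisect G S : {fset rect R} := foldl bisect1 G (enum_fset S).

Definition admissible1 (p q : nat) G K : Prop :=
  K \in G /\ forall K', K' \in patch p q G K -> level K <= level K'.

Fixpoint admissible_seq (p q : nat) G (s : seq (rect R)) : Prop :=
  if s is K :: s' then admissible1 p q G K /\ admissible_seq p q (bisect1 G K) s'
  else True.

Definition admissible_bisect (p q : nat) G S : Prop :=
  exists2 s : seq (rect R), perm_eq s (enum_fset S) & admissible_seq p q G s.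

Inductive admissible (p q M N : nat) : {fset rect R} -> Prop :=
| admissible_mesh0 : admissible p q M N (mesh0 M N)
| admissible_step G S :
    admissible p q M N G -> S `<=` G -> admissible_bisect p q G S ->
    admissible p q M N (bisect G S).

Definition patch_closed (p q : nat) G T : Prop :=
  forall K K', K \in T -> K' \in patch p q G K -> level K' < level K -> K' \in T.

(* The smallest patch-closed T with S `<=` T `<=` G, as the intersection of all
   of them. *)
Definition clos (p q : nat) G S : {fset rect R} :=
  [fset K in G | `[< forall T, S `<=` T -> T `<=` G ->
                       patch_closed p q G T -> K \in T >]].

Definition ref (p q : nat) G S : {fset rect R} := bisect G (clos p q G S).

End Meshes.

Section Constants.
Context {R : realType}.

Definition d_p (p : nat) : R :=
  1 / 2 + (1 + Num.sqrt 2) * (p%:R + Num.sqrt 2).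

Definition d_q (q : nat) : R :=
  1 / Num.sqrt 2 + (2 + Num.sqrt 2) * (q%:R + Num.sqrt 2).

Definition C_pq (p q : nat) : R :=
  (3 + Num.sqrt 2) * (4 * d_p p + 1) * (4 * d_q q + Num.sqrt 2).

End Constants.

(* Main.v *)
Require Import Defs.
From mathcomp Require Import all_boot all_order all_algebra finmap.
From mathcomp Require Import all_classical all_reals all_analysis.
From mathcomp Require Import ring lra zify.
Import Order.TTheory GRing.Theory Num.Theory.
Set Implicit Arguments.
Unset Strict Implicit.
Unset Printing Implicit Defensive.
Local Open Scope fset_scope.
Local Open Scope ring_scope.

(* Every element K created by a refinement step comes from a marked element K'
   with lev K <= lev K' + 1 and Dist K K' <= 2^(-lev K / 2) (d_p, d_q).  A pair
   (K, K') with lev K <= lev K' + 1 and Dist K K' <= 2^(1 - lev K / 2) (d_p, d_q)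
   gets the weight min(1, 2^((lev K - lev K') / 2)), any other pair gets 0.
   Following the generators of K backwards in time shows that the weights of the
   pairs (K, .) sum up to at least 1: either the chain reaches level lev K - 1
   or it leaves the disc, and its length is bounded by the weights it collects.
   All elements are dyadic cells, so counting grid points level by level bounds
   the sum of the weights of the pairs (., K') by C_pq.  The double sum of the
   weights then gives the estimate. *)

(** * Dyadic cells: sizes, bisection and grid counts *)

Section DyadicCells.
Context {R : realType}.
Implicit Types (K : rect R) (l a b : nat).

Notation s := (Num.sqrt 2 : R).

Lemma sqrt2_sqr : s * s = 2.
Proof. by rewrite -expr2 sqr_sqrtr. Qed.

Lemma sqrt2_gt1 : 1 < s.
Proof. by rewrite -[ltLHS]sqrtr1 ltr_sqrt // ltr1n. Qed.

(** This is 2^(-l/2); as a power of [s] it reduces the estimates to algebra with [s * s = 2]. *)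
Definition scale l : R := s ^- l.

Lemma scale_gt0 l : 0 < scale l.
Proof. by rewrite invr_gt0 exprn_gt0 // sqrtr_gt0. Qed.

Lemma scaleS l : scale l = s * scale l.+1.
Proof.
have := sqrt2_gt1 => s1.
by rewrite /scale exprS invfM mulrA divff ?mul1r //; lra.
Qed.

Lemma scale_double l : scale l.*2 = 2 ^- l.
Proof. by rewrite /scale -muln2 mulnC exprM sqr_sqrtr. Qed.

Lemma scale_add l m : scale (l + m) = scale l * scale m.
Proof. by rewrite /scale exprD invfM. Qed.

Lemma scale_anti l m : (l <= m)%N -> scale m <= scale l.
Proof.
move=> lm; have := sqrt2_gt1 => s1.
rewrite /scale lef_pV2 ?posrE ?exprn_gt0 ?sqrtr_gt0 //.
by rewrite ler_weXn2l // ltW.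
Qed.

Lemma powR_scale l : 2 `^ (- (l%:R / 2)) = scale l :> R.
Proof.
rewrite powRN /scale; congr (_^-1).
by rewrite mulrC powRrM -powR12_sqrt // powR_mulrn ?powR_ge0 // mul1r.
Qed.

(** The cuts alternate, beginning in the x-direction, so a unit square has been halved [uphalf l]
    times in x and [l./2] times in y. *)
Definition cell l a b : rect R :=
  let hx := 2 ^- uphalf l in let hy := 2 ^- l./2 in
  Rect (a%:R * hx) (a.+1%:R * hx) (b%:R * hy) (b.+1%:R * hy).

Lemma width_even l : ~~ odd l -> 2 ^- uphalf l = scale l :> R.
Proof. by move=> ol; rewrite -scale_double uphalf_half (negPf ol) even_halfK. Qed.

Lemma width_odd l : odd l -> 2 ^- uphalf l = scale l.+1 :> R.
Proof. by move=> ol; rewrite -scale_double odd_uphalfK. Qed.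

Lemma height_even l : ~~ odd l -> 2 ^- l./2 = scale l :> R.
Proof. by move=> ol; rewrite -scale_double even_halfK. Qed.

Lemma height_odd l : odd l -> 2 ^- l./2 = s * scale l :> R.
Proof.
move=> ol; rewrite -scale_double odd_halfK //.
by rewrite -{2}(ltn_predK (odd_gt0 ol)) -scaleS. Qed.

Lemma level_cell l a b : level (cell l a b) = l%:R.
Proof.
have area_cell : area (cell l a b) = 2 ^- l.
  rewrite /area /= -!mulrBl -!natrB // !subSnn !mul1r -invfM -exprD.
  by rewrite uphalf_half -addnA addnn odd_double_half.
rewrite /level area_cell lnV ?posrE ?exprn_gt0 // lnXn // mulNr opprK.
by rewrite -[ln 2 *+ l]mulr_natl mulfK // gt_eqF // ln_gt0 // ltr1n.
Qed.

Lemma even_level_nat l : even_level (l%:R : R) = ~~ odd l.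
Proof.
rewrite /even_level; apply/idP/idP => [/intrP[z zE]|ol].
  have /eqP: (l%:R : R) = (z * 2)%:~R.
    by rewrite intrM -zE -[2%:~R]/2; field.
  rewrite pmulrn eqr_int => /eqP; lia.
apply/intrP; exists (l./2 : int); rewrite -[in LHS](even_halfK ol).
by rewrite -muln2 natrM mulfK // pnatr_eq0.
Qed.

Lemma halve_interval (h : R) (c : nat) :
  [/\ c%:R * h = c.*2%:R * (h / 2), (c%:R * h + c.+1%:R * h) / 2 = c.*2.+1%:R * (h / 2) &
      c.+1%:R * h = c.*2.+2%:R * (h / 2)].
Proof.
rewrite -muln2 -[c.+1%:R]natr1 -[(c * 2).+1%:R]natr1 -[(c * 2).+2%:R]natr1.
by rewrite -[(c * 2).+1%:R]natr1 natrM; split; field.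
Qed.

(** The midpoint moves by a quarter of the side being cut, which is [scale l] for even [l] and
    [s * scale l] for odd [l]. *)
Lemma child_cell l a b K : K \in child (cell l a b) ->
  exists a' b', [/\ K = cell l.+1 a' b', (Dist K (cell l a b)).1 <= scale l / 4 &
    (Dist K (cell l a b)).2 <= s * scale l / 4].
Proof.
have w0 := scale_gt0 l; have s1 := sqrt2_gt1.
have sw0 : 0 < s * scale l by rewrite mulr_gt0 //; lra.
have ul : uphalf l.+1 = (l./2).+1 by []; have ul2 : l.+1./2 = uphalf l by [].
have invS m : 2 ^- m.+1 = 2 ^- m / 2 :> R by rewrite exprS invfM mulrC.
rewrite /child level_cell even_level_nat; case: ifP => ol.
{ have ew : uphalf l = l./2 by rewrite uphalf_half (negPf ol).
  have hw := height_even ol.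
  have [h1 h2 h3] := halve_interval (2 ^- l./2) a.
  rewrite /= ew !inE => /orP[] /eqP ->; [exists a.*2, b|exists a.*2.+1, b].
  all: rewrite /cell ul ul2 ew invS /Dist /= ?ew h2 ?h1 ?h3; split=> //.
  all: rewrite hw ?subrr ?normr0; try lra.
  all: by rewrite ler_norml -?[_.*2.+2%:R]natr1 -[_.*2.+1%:R]natr1; lra. }
move/negbFE: ol => ol.
have hw := height_odd ol; have ew : uphalf l = (l./2).+1 by rewrite uphalf_half ol.
have [h1 h2 h3] := halve_interval (2 ^- l./2) b.
rewrite /= !inE => /orP[] /eqP ->; [exists a, b.*2|exists a, b.*2.+1].
all: rewrite /cell ul ul2 ew invS /Dist /= h2 ?h1 ?h3; split=> //.
all: rewrite hw ?subrr ?normr0; try lra.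
all: by rewrite ler_norml -?[_.*2.+2%:R]natr1 -[_.*2.+1%:R]natr1; lra.
Qed.

Lemma mesh0_cell M N K : K \in mesh0 M N -> exists a b, K = cell 0 a b.
Proof.
case/imfset2P => m /= ; rewrite mem_iota => /andP[m1 _] [n].
rewrite mem_iota => /andP[n1 _] ->; exists m.-1, n.-1.
by rewrite /cell /= expr0 invr1 !mulr1 !prednK // -!subn1 !natrB.
Qed.

Lemma Dpq_le (p q l : nat) :
  (Dpq p q (l%:R : R)).1 <= scale l * ((p%:R + s) / 2) /\
  (Dpq p q (l%:R : R)).2 <= scale l * (s * (q%:R + s) / 2).
Proof.
have w0 := scale_gt0 l; have s1 := sqrt2_gt1; have s2 := sqrt2_sqr.
have lehalf n : (n./2)%:R * 2 <= n%:R :> R.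
  by rewrite -natrM ler_nat muln2 -{2}(odd_double_half n) leq_addl.
have leuphalf n : (uphalf n)%:R * 2 <= n%:R + 1 :> R.
  by rewrite -natrM natr1 ler_nat muln2; lia.
have hp := lehalf p; have hq := lehalf q.
have up := leuphalf p; have uq := leuphalf q.
(* The ceilings in [Dpq] lead to (n + 2) / 2; trading this for a factor [s] gives one bound for both
   parities. *)
have sn n : n%:R + 2 <= s * (n%:R + s) :> R.
  have : 0 <= (s - 1) * n%:R by rewrite mulr_ge0 //; lra.
  by rewrite mulrDr s2; lra.
have sp := sn p; have sq := sn q.
rewrite /Dpq even_level_nat; case: ifP => _ /=.
  by rewrite powR_scale !ler_pM2l //; split; lra.
rewrite natr1 powR_scale (scaleS l) -!(mulrC (scale l.+1)) -!mulrA !ler_pM2l ?scale_gt0 //.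
by rewrite !mulrA s2; split; lra.
Qed.

(** Midpoints are [h] apart, so the indices within [r] of [x] lie in a window of length 2r/h that
    starts at the least such index. *)
Lemma grid_count (h r x : R) : 0 < h -> 0 <= r -> exists a0 n : nat,
  n%:R <= 2 * r / h + 1 /\
  forall a : nat, `|(a%:R * h + a.+1%:R * h) / 2 - x| <= r -> a \in iota a0 n.
Proof.
move=> h0 r0; have rh0 : 0 <= 2 * r / h by rewrite divr_ge0 ?mulr_ge0 // ltW.
pose P a := `|(a%:R * h + a.+1%:R * h) / 2 - x| <= r.
case: (pselect (exists a, P a)) => [exP|nP]; last first.
  by exists 0, 0; split=> [|a Pa]; [rewrite addr_ge0|case: nP; exists a].
case: (ex_minnP exP) => a0 P0 min0; exists a0, (Num.truncn (2 * r / h)).+1; split.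
  by rewrite -natr1 lerD2r truncn_le.
move=> a Pa; have a0a := min0 _ Pa.
rewrite mem_iota a0a addnS ltnS -leq_subLR truncn_ge_nat // natrB //.
rewrite ler_pdivlMr //; move: Pa P0; rewrite /P !ler_norml -[a.+1%:R]natr1 -[a0.+1%:R]natr1.
move=> /andP[_ Pa] /andP[P0 _]; lra.
Qed.

End DyadicCells.

(** * One refinement step, and the weights *)

Section Refinement.
Context {R : realType}.
Context (p q : nat).
Implicit Types (K : rect R) (G S X : {fset rect R}) (l a b j k : nat).

Notation s := (Num.sqrt 2 : R).

(** Truncation loses nothing on cells, whose level is a natural number. *)
Definition lev K : nat := Num.truncn (level K).

Definition dyadic K := exists a b, K = cell (lev K) a b.

Lemma lev_cell l a b : lev (cell l a b : rect R) = l.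
Proof. by rewrite /lev level_cell natrK. Qed.

Lemma dyadic_cell l a b : dyadic (cell l a b).
Proof. by exists a, b; rewrite lev_cell. Qed.

Lemma dyadic_level K : dyadic K -> level K = (lev K)%:R.
Proof. by move=> [a [b ->]]; rewrite lev_cell level_cell. Qed.

Lemma d_p_gt0 : 0 < d_p p :> R.
Proof.
have := @sqrt2_gt1 R => s1; have p0 : 0 <= p%:R :> R by [].
by rewrite /d_p; nra.
Qed.

Lemma d_q_gt0 : 0 < d_q q :> R.
Proof.
have := @sqrt2_gt1 R => s1; have q0 : 0 <= q%:R :> R by [].
have : 0 < 1 / s by rewrite divr_gt0 //; lra.
by rewrite /d_q; nra.
Qed.

Definition close r K1 K2 : bool :=
  ((Dist K1 K2).1 <= r * d_p p) && ((Dist K1 K2).2 <= r * d_q q).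

Lemma Dist_trans K1 K2 K3 :
  (Dist K1 K3).1 <= (Dist K1 K2).1 + (Dist K2 K3).1 /\
  (Dist K1 K3).2 <= (Dist K1 K2).2 + (Dist K2 K3).2.
Proof. by split; apply: ler_distD. Qed.

Lemma close_trans r1 r2 K1 K2 K3 :
  close r1 K1 K2 -> close r2 K2 K3 -> close (r1 + r2) K1 K3.
Proof.
have [t1 t2] := Dist_trans K1 K2 K3.
move=> /andP[a1 a2] /andP[b1 b2]; apply/andP.
by rewrite !mulrDl; split; [apply: le_trans t1 _|apply: le_trans t2 _]; apply: lerD.
Qed.

Lemma close_weaken r1 r2 K1 K2 : r1 <= r2 -> close r1 K1 K2 -> close r2 K1 K2.
Proof.
move=> r12 /andP[a1 a2]; apply/andP; split.
  by apply: le_trans a1 _; rewrite ler_wpM2r // ltW // d_p_gt0.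
by apply: le_trans a2 _; rewrite ler_wpM2r // ltW // d_q_gt0.
Qed.

Lemma mem_foldl_bisect1 G (r : seq (rect R)) K : K \in foldl bisect1 G r ->
  K \in G \/ exists2 K0, K0 \in r & K \in child K0.
Proof.
elim: r G => [|K0 r IH] G /=; first by left.
case/IH => [|[K1 K1r K1c]]; last by right; exists K1; rewrite // inE K1r orbT.
rewrite !inE => /orP[/andP[_]|Kc]; first by left.
by right; exists K0; rewrite // inE eqxx.
Qed.

(* Along a chain of patch neighbours the level increases by at least one at
   each step, so that the distances are dominated by a telescoping sum. *)
Lemma clos_close G S K : (forall K, K \in G -> dyadic K) -> S `<=` G ->
  K \in clos p q G S -> exists2 K', K' \in S &
  [/\ (lev K <= lev K')%N,
    (Dist K K').1 <= (1 + s) * ((p%:R + s) / 2) * (scale (lev K) - scale (lev K')) &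
    (Dist K K').2 <= (1 + s) * (s * (q%:R + s) / 2) * (scale (lev K) - scale (lev K'))].
Proof.
move=> dyG SG; rewrite inE => /andP[KG /asboolP minK].
(* By minimality of the closure it suffices that the elements of [G] satisfying the estimate contain
   [S] and are patch-closed. *)
pose good K := exists2 K', K' \in S &
  [/\ (lev K <= lev K')%N,
    (Dist K K').1 <= (1 + s) * ((p%:R + s) / 2) * (scale (lev K) - scale (lev K')) &
    (Dist K K').2 <= (1 + s) * (s * (q%:R + s) / 2) * (scale (lev K) - scale (lev K'))].
have : K \in [fset K in G | `[< good K >]].
  apply: minK.
  - apply/fsubsetP => K1 K1S; rewrite !inE (fsubsetP SG) //=; apply/asboolP.
    by exists K1 => //; rewrite /Dist !subrr normr0 !mulr0; split.
  - by apply/fsubsetP => K1; rewrite inE => /andP[].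
  move=> K1 K2; rewrite !inE => /andP[K1G /asboolP[K' K'S [lK' D1 D2]]].
  move=> /andP[K2G /andP[E1 E2]].
  rewrite !dyadic_level; [|exact: dyG|exact: dyG].
  rewrite ltr_nat => l21; rewrite K2G; apply/asboolP.
  have l2' : (lev K2 <= lev K')%N := leq_trans (ltnW l21) lK'.
  have [t1 t2] := Dist_trans K2 K1 K'.
  move: E1 E2; rewrite dyadic_level; last exact: dyG.
  have [P1 P2] := @Dpq_le R p q (lev K1); move=> E1 E2.
  (* As [K2] is at least one level lower, [scale (lev K2)] is at least [s * scale (lev K1)]. Since
     (1 + s)(s - 1) = 1, the telescoping difference pays for one patch radius. *)
  have gap : scale (lev K1) <= (1 + s) * (scale (lev K2) - scale (lev K1)) :> R.
    have := @scale_anti R _ _ l21; rewrite (scaleS (lev K2)) => w21.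
    have s1 := @sqrt2_gt1 R; have s2 := @sqrt2_sqr R.
    have : 0 <= (2 + s) * (scale (lev K2).+1 - scale (lev K1)).
      by rewrite mulr_ge0 ?subr_ge0 //; lra.
    have -> : (1 + s) * (s * scale (lev K2).+1 - scale (lev K1)) =
      (s * s + s) * scale (lev K2).+1 - (1 + s) * scale (lev K1) by ring.
    by rewrite s2; lra.
  exists K' => //; split=> //.
    apply: le_trans t1 _; apply: le_trans (lerD (le_trans E1 P1) D1) _.
    have c0 : 0 <= (p%:R + s) / 2 by rewrite divr_ge0 ?addr_ge0 ?sqrtr_ge0.
    by have := ler_wpM2l c0 gap; lra.
  apply: le_trans t2 _; apply: le_trans (lerD (le_trans E2 P2) D2) _.
  have c0 : 0 <= s * (q%:R + s) / 2 by rewrite divr_ge0 ?mulr_ge0 ?addr_ge0 ?sqrtr_ge0.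
  by have := ler_wpM2l c0 gap; lra.
by rewrite !inE => /andP[_ /asboolP].
Qed.

(** A new element is a child of some [K0] in the closure; the triangle inequality adds the shift
    from [K0] to its child to the distance in [clos_close]. *)
Lemma ref_new G S K : (forall K, K \in G -> dyadic K) -> S `<=` G ->
  K \in ref p q G S -> K \in G \/ exists2 K', K' \in S &
    [/\ dyadic K, (0 < lev K)%N, (lev K <= (lev K').+1)%N & close (scale (lev K)) K K'].
Proof.
move=> dyG SG /mem_foldl_bisect1[|[K0 K0clos KK0]]; first by left.
right; have [K' K'S [l0' D1 D2]] := clos_close dyG SG K0clos.
exists K' => //.
have [a [b K0E]] : dyadic K0 by apply: dyG; move: K0clos; rewrite inE => /andP[].
move: KK0; rewrite {1}K0E => /child_cell[a' [b' [KE E1 E2]]].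
rewrite -K0E in E1 E2.
have lK : lev K = (lev K0).+1 by rewrite KE lev_cell.
rewrite lK; split=> //; first by rewrite KE; apply: dyadic_cell.
have [t1 t2] := Dist_trans K K0 K'.
have s1 := @sqrt2_gt1 R; have s2 := @sqrt2_sqr R.
have w0 : 0 < scale (lev K0).+1 :> R := scale_gt0 _.
have W'0 : 0 < scale (lev K') :> R := scale_gt0 _.
have s_lt2 : s < 2 by nra.
rewrite (scaleS (lev K0)) in D1 D2 E1 E2.
set W := scale (lev K0).+1 in w0 D1 D2 E1 E2 *; set W' := scale (lev K') in W'0 D1 D2.
have q0 : 0 <= (1 + s) * (q%:R + s) by rewrite mulr_ge0 ?addr_ge0 //; lra.
have p0 : 0 <= (1 + s) * (p%:R + s) by rewrite mulr_ge0 ?addr_ge0 //; lra.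
apply/andP; split.
  apply: le_trans t1 _; apply: le_trans (lerD E1 D1) _.
  have -> : s * W / 4 + (1 + s) * ((p%:R + s) / 2) * (s * W - W') =
    W * (s / 4 + (1 + s) * (p%:R + s) * s / 2)
      - (1 + s) * (p%:R + s) * W' / 2 by field.
  have : 0 <= (1 + s) * (p%:R + s) * W' by rewrite mulr_ge0 // ltW.
  (* [d_p] absorbs both terms because s / 4 <= 1 / 2 and s / 2 <= 1. *)
  have : s / 4 + (1 + s) * (p%:R + s) * s / 2 <= d_p p.
    have : 0 <= (1 + s) * (p%:R + s) * (2 - s) by rewrite mulr_ge0 //; lra.
    by rewrite /d_p; lra.
  by move/(ler_wpM2l (ltW w0)); lra.
apply: le_trans t2 _; apply: le_trans (lerD E2 D2) _.
have -> : s * (s * W) / 4 + (1 + s) * (s * (q%:R + s) / 2) * (s * W - W') =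
  W * (s * s) * (1 / 4 + (1 + s) * (q%:R + s) / 2)
    - (1 + s) * (q%:R + s) * s * W' / 2 by field.
have : 0 <= (1 + s) * (q%:R + s) * s * W' by rewrite !mulr_ge0 //; lra.
have : 2 * (1 / 4 + (1 + s) * (q%:R + s) / 2) <= d_q q.
  have -> : d_q q = s / 2 + (2 + s) * (q%:R + s).
    rewrite /d_q; congr (_ + _); apply/eqP.
    by rewrite eqr_div ?s2 ?mul1r //; lra.
  have : 0 <= q%:R + s by rewrite addr_ge0 //; lra.
  by lra.
by move/(ler_wpM2l (ltW w0)); rewrite s2; lra.
Qed.

(** A cell of level [l] is determined by its two grid indices, so two one-dimensional counts
    multiply. *)
Lemma count_close X K l (r : R) : (forall K, K \in X -> dyadic K) -> 0 <= r ->
  (size [seq K' <- X | (lev K' == l) && close r K' K])%:R <=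
  (2 * (r * d_p p) / 2 ^- uphalf l + 1) * (2 * (r * d_q q) / 2 ^- l./2 + 1) :> R.
Proof.
move=> dyX r0.
have pos m : 0 < 2 ^- m :> R by rewrite invr_gt0 exprn_gt0.
have rp : 0 <= r * d_p p by rewrite mulr_ge0 // ltW // d_p_gt0.
have rq : 0 <= r * d_q q by rewrite mulr_ge0 // ltW // d_q_gt0.
have [a0 [n [nle mem_a]]] := grid_count (mid K).1 (pos (uphalf l)) rp.
have [b0 [m [mle mem_b]]] := grid_count (mid K).2 (pos l./2) rq.
apply: le_trans (ler_pM (ler0n _ _) (ler0n _ _) nle mle).
pose cells := [seq cell l a b : rect R | a <- iota a0 n, b <- iota b0 m].
have sz : size cells = (n * m)%N by rewrite size_allpairs !size_iota.
rewrite -natrM ler_nat -sz uniq_leq_size ?filter_uniq ?fset_uniq // => K'.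
rewrite mem_filter => /andP[/andP[/eqP lK' /andP[D1 D2]] K'X].
have [a [b K'E]] := dyX _ K'X; rewrite lK' in K'E.
rewrite K'E; apply: allpairs_f.
  by apply: mem_a; move: D1; rewrite K'E.
by apply: mem_b; move: D2; rewrite K'E.
Qed.

Lemma count_close_level X K l : (forall K, K \in X -> dyadic K) ->
  (size [seq K' <- X | (lev K' == l) && close (2 * scale l) K' K])%:R <=
  (4 * d_p p + 1) * (4 * d_q q + s) :> R.
Proof.
move=> dyX; have w0 : 0 < scale l :> R := scale_gt0 l.
apply: le_trans (count_close K l dyX (ltW (mulr_gt0 (ltr0n _ 2) w0))) _.
have s1 := @sqrt2_gt1 R; have s2 := @sqrt2_sqr R.
have p0 := d_p_gt0; have q0 := d_q_gt0.
have [ol|ol] := boolP (odd l); last first.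
  rewrite width_even // height_even //.
  have cancel_w (d : R) : 2 * (2 * scale l * d) / scale l = 4 * d by field; lra.
  by rewrite !cancel_w ler_pM2l; lra.
have w1 : 0 < scale l.+1 :> R := scale_gt0 l.+1.
rewrite width_odd // height_odd // (scaleS l).
have -> : 2 * (2 * (s * scale l.+1) * d_p p) / scale l.+1 = 4 * d_p p * s by field; lra.
have -> : 2 * (2 * (s * scale l.+1) * d_q q) / (s * (s * scale l.+1)) = 4 * d_q q / s.
  by field; lra.
(* For odd levels a factor [s] moves from the x-count to the y-count; this is the source of the [s]
   in the last factor of [C_pq]. *)
have -> : (4 * d_p p * s + 1) * (4 * d_q q / s + 1) =
    (4 * d_p p + s^-1) * (4 * d_q q + s) by field; lra.
rewrite ler_pM2r; last lra.
by rewrite lerD2l invf_le1; lra.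
Qed.

(** Geometric series of ratio 1/s, with limit s / (s - 1) = 2 + s. *)
Lemma sum_scale n : \sum_(i < n) scale i <= 2 + s :> R.
Proof.
have s1 := @sqrt2_gt1 R; have s2 := @sqrt2_sqr R.
suff -> : \sum_(i < n) scale i = (2 + s) * (1 - scale n) :> R.
  by rewrite ler_piMr ?gerDl ?oppr_le0 ?ltW ?scale_gt0 //; lra.
elim: n => [|n IH]; first by rewrite big_ord0 /scale expr0 invr1 subrr mulr0.
rewrite big_ord_recr /= IH (scaleS n).
have -> : (2 + s) * (1 - s * scale n.+1) = (2 + s) - (2 * s + s * s) * scale n.+1 by ring.
by rewrite s2; ring.
Qed.

(* The truncated subtraction caps the weight at 1 when [k = (lev K').+1]; the
   uncapped weights would only give the factor 2 + 2 sqrt 2 in [C_pq]. *)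
Definition weight k r K K' : R :=
  if (k <= (lev K').+1)%N && close r K K' then scale (lev K' - k) else 0.

Lemma weight_ge0 k r K K' : 0 <= weight k r K K'.
Proof. by rewrite /weight; case: ifP => // _; rewrite ltW // scale_gt0. Qed.

(** The reference level [k] is independent of the centre, so the disc can be recentred along a chain
    of generators at the cost of radius only. *)
Lemma weight_trans k r1 r2 K1 K2 K : close r1 K1 K2 ->
  weight k r2 K2 K <= weight k (r1 + r2) K1 K.
Proof.
move=> K12; rewrite {1}/weight; case: ifP => [/andP[kK K2K]|_].
  by rewrite /weight kK (close_trans K12 K2K).
exact: weight_ge0.
Qed.

(** Each level [l] has at most [B] close elements, of weight [scale (lev K' - l)]. The levels up to
    [lev K'] give a geometric sum of at most 2 + s, and the level [(lev K').+1] adds 1. *)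
Lemma sum_weight_le X K' : (forall K, K \in X -> dyadic K) ->
  \sum_(K <- X) weight (lev K) (2 * scale (lev K)) K K' <= C_pq p q.
Proof.
move=> dyX; set B := (4 * d_p p + 1) * (4 * d_q q + s).
have p0 := d_p_gt0; have q0 := d_q_gt0; have s1 := @sqrt2_gt1 R.
have B0 : 0 <= B by rewrite mulr_ge0; lra.
have -> : \sum_(K <- X) weight (lev K) (2 * scale (lev K)) K K' =
  \sum_(K <- X) \sum_(l < (lev K').+2)
     (if (lev K == l) && close (2 * scale l) K K' then scale (lev K' - l) else 0).
  apply: eq_bigr => K _; rewrite /weight -ltnS.
  have [lK|lK] := ltnP (lev K) (lev K').+2.
    rewrite (bigD1 (Ordinal lK)) //= eqxx /= big1 ?addr0 // => i.
    by rewrite -val_eqE /= eq_sym => /negPf ->.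
  rewrite big1 // => i _; case: eqP => // lKi.
  by move: lK; rewrite lKi leqNgt ltn_ord.
rewrite exchange_big /=.
apply: (@le_trans _ _ (\sum_(l < (lev K').+2) scale (lev K' - l) * B)).
  apply: ler_sum => l _; rewrite -big_mkcond /= -big_filter big_const_seq.
  rewrite count_predT iter_addr_0 -[leLHS]mulr_natr.
  by rewrite ler_pM2l ?scale_gt0 //; apply: count_close_level.
rewrite -mulr_suml (_ : C_pq p q = (3 + s) * B); last by rewrite /C_pq mulrA.
apply: ler_wpM2r => //; rewrite big_ord_recr /= (eqP (leqnSn _ : _ - _ == 0)%N).
have -> : \sum_(i < (lev K').+1) scale (lev K' - i) = \sum_(i < (lev K').+1) scale i :> R.
  rewrite [RHS](reindex_inj rev_ord_inj) /=.
  by apply: eq_bigr => i _; rewrite subSS.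
by have := sum_scale (lev K').+1; rewrite [scale 0]/scale expr0 invr1; lra.
Qed.
End Refinement.

(** * Sequences of refinements *)

Section RefinementSequence.
Context {R : realType} (p q M N J : nat) (G Ms : nat -> {fset rect R}).
Context (hG0 : G 0%N = mesh0 M N).
Context (hS : forall j, (j < J)%N -> Ms j `<=` G j).
Context (href : forall j, (j < J)%N -> G j.+1 = ref p q (G j) (Ms j)).
Implicit Types (K : rect R) (j k : nat).

Lemma ref_seq_dyadic j K : (j <= J)%N -> K \in G j ->
  dyadic K /\ (K \notin mesh0 M N -> (0 < lev K)%N).
Proof.
elim: j K => [|j IH] K jJ.
  rewrite hG0 => K0; split; last by rewrite K0.
  by have [a [b ->]] := mesh0_cell K0; apply: dyadic_cell.
rewrite href //; case/(ref_new _ (hS jJ)) => [K1 K1G| |[K' _ []]] //.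
  by have [] := IH _ (ltnW jJ) K1G.
exact: IH (ltnW jJ).
Qed.

(* The generator [K'] of [K] is either one level below [k], and then has weight
   at least 1, or else one proceeds with the generator of [K'], having spent
   the radius [scale (lev K)] and gained the weight [scale (lev K') / scale k]. *)
Lemma sum_weight_ge j k (r t : R) K : (j <= J)%N -> K \in G j ->
  (0 < k <= lev K)%N -> t <= 1 -> t * scale k + scale (lev K) <= r ->
  t <= \sum_(i < j) \sum_(K' <- Ms i) weight p q k r K K'.
Proof.
elim: j r t K => [|j IH] r t K jJ.
  (* Initial elements have level 0, contradicting [0 < k <= lev K]. *)
  rewrite hG0 => /mesh0_cell[a [b ->]]; rewrite lev_cell; lia.
have sum_ge0 (i : nat) r' K1 : 0 <= \sum_(K' <- Ms i) weight p q k r' K1 K'.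
  by apply: sumr_ge0 => K' _; apply: weight_ge0.
have dyG K1 : K1 \in G j -> dyadic K1 by move/(ref_seq_dyadic (ltnW jJ)) => [].
rewrite href // => KG klev t1 tr; rewrite big_ord_recr /=.
case/(ref_new dyG (hS jJ)): KG => [KG|[K' K'S [_ _ lKK' nKK']]].
  by apply: le_trans (IH _ _ _ (ltnW jJ) KG klev t1 tr) _; rewrite lerDl.
have rest_ge0 : 0 <= \sum_(i < j) \sum_(K' <- Ms i) weight p q k r K K'.
  by apply: sumr_ge0 => i _.
(* [t] is the weight still to be collected. *)
have [t0|t0] := leP t 0.
  by apply: le_trans t0 _; rewrite addr_ge0.
have wk : 0 < scale k :> R := scale_gt0 k.
have rK : scale (lev K) <= r by apply: le_trans tr; rewrite lerDr mulr_ge0 ?ltW.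
have kK' : (k <= (lev K').+1)%N by case/andP: klev => _ /leq_trans; apply.
have step : scale (lev K' - k) <= \sum_(K1 <- Ms j) weight p q k r K K1.
  rewrite (bigD1_seq K') ?fset_uniq //= {1}/weight kK' (close_weaken rK nKK').
  by rewrite lerDl sumr_ge0 // => K1 _; apply: weight_ge0.
(* If [lev K' < k], truncated subtraction makes the weight 1, which is at least [t]. *)
have [kE|k_le] := leqP k (lev K'); last first.
  apply: le_trans t1 _; apply: le_trans (le_trans _ step) _.
    by rewrite (_ : lev K' - k = 0)%N ?/scale ?expr0 ?invr1 //; lia.
  by rewrite lerDr.
(* The next radius is the weight just gained times [scale k], so lowering [t] by that weight and [r]
   by [scale (lev K)] preserves the budget inequality. *)
have wE : scale (lev K') = scale (lev K' - k) * scale k :> R by rewrite -scale_add subnK.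
have K'G := fsubsetP (hS jJ) _ K'S.
have {}IH : t - scale (lev K' - k) <=
    \sum_(i < j) \sum_(K1 <- Ms i) weight p q k (r - scale (lev K)) K' K1.
  apply: IH (ltnW jJ) K'G _ _ _.
  - by rewrite kE andbT; case/andP: klev.
  - by have := scale_gt0 (R := R) (lev K' - k); lra.
  by rewrite wE mulrBl; lra.
have := le_trans IH (ler_sum _ (fun i _ => ler_sum _ (fun K1 _ =>
  weight_trans k (r - scale (lev K)) K1 nKK'))).
by rewrite (addrC (scale _)) subrK => {}IH; lra.
Qed.
End RefinementSequence.

Theorem theorem6p1 (R : realType) (p q M N : nat)
  (hp : (2 <= p)%N) (hq : (2 <= q)%N) (hM : (0 < M)%N) (hN : (0 < N)%N)
  (J : nat) (G Ms : nat -> {fset rect R})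
  (hG0 : G 0%N = mesh0 M N)
  (hadm : forall j, (j <= J)%N -> admissible p q M N (G j))
  (hS : forall j, (j < J)%N -> Ms j `<=` G j)
  (href : forall j, (j < J)%N -> G j.+1 = ref p q (G j) (Ms j)) :
  (#|` G J `\` mesh0 M N|)%:R <= C_pq p q * \sum_(j < J) (#|` Ms j|)%:R :> R.
Proof.
set X := G J `\` mesh0 M N.
have dyJ K : K \in X -> [/\ K \in G J, dyadic K & (0 < lev K)%N].
  rewrite inE => /andP[K0 KG].
  by have [dK lK] := ref_seq_dyadic hG0 hS href (leqnn J) KG; split=> //; apply: lK.
have dyX K : K \in X -> dyadic K by case/dyJ.
apply: (@le_trans _ _ (\sum_(K <- X) \sum_(j < J) \sum_(K' <- Ms j)
    weight p q (lev K) (2 * scale (lev K)) K K')).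
  rewrite -sum1_size natr_sum !big_seq.
  apply: ler_sum => K /dyJ[KG _ lK].
  (* With [k = lev K] and [t = 1] the budget is exactly [2 * scale (lev K)], the radius chosen in
     the weights. *)
  apply: (sum_weight_ge hG0 hS href) KG _ _ _ => //; first by rewrite lK leqnn.
  by rewrite mul1r mulr_natl mulr2n.
rewrite exchange_big mulr_sumr /=; apply: ler_sum => j _.
rewrite exchange_big /=.
apply: le_trans (ler_sum _ (fun K' _ => sum_weight_le p q K' dyX)) _.
by rewrite big_const_seq count_predT iter_addr_0 mulr_natr.
Qed.
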